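(* Let $A$ be a finite alphabet, let $S\subseteq A^*$ be a recurrent set containing $A$, and let $X\subseteq S$ be a finite $S$-maximal bifix code. Set $k=\mathrm{Card}(A)-1$ and let $d$ be the $S$-degree of $X$. If $S$ is strong, then $\mathrm{Card}(X)-1\ge dk$; if $S$ is weak, then $\mathrm{Card}(X)-1\le dk$; if $S$ is neutral, then $\mathrm{Card}(X)-1=dk$.
   Context: A set $S$ of words is factorial if it contains all factors of its elements. $S\neq\{1\}$ (with $1$ the empty word) is recurrent if it is factorial and for all $u,w\in S$ there is $v\in S$ with $uvw\in S$. For $w\in S$ let $L(w)=\{a\in A: aw\in S\}$, $R(w)=\{a\in A: wa\in S\}$, $E(w)=\{(a,b)\in A\times A: awb\in S\}$, $\ell(w)=\mathrm{Card}\,L(w)$, $r(w)=\mathrm{Card}\,R(w)$, $e(w)=\mathrm{Card}\,E(w)$, and $m(w)=e(w)-\ell(w)-r(w)+1$. A factorial set $S$ is strong (resp. weak, resp. neutral) if $m(w)\ge 0$ (resp. $m(w)\le 0$, resp. $m(w)=0$) for every $w\in S$. A prefix code is a set of nonempty words none of which is a proper prefix of another; suffix codes are defined symmetrically; a bifix code is both. A bifix code $X\subseteq S$ is $S$-maximal if it is not properly contained in any bifix code $Y\subseteq S$. A parse of a word $w$ with respect to $X$ is a triple $(v,x,u)$ with $w=vxu$, $v$ has no suffix in $X$, $u$ has no prefix in $X$, $x\in X^*$. The $S$-degree of $X$ is the maximal number of parses of a word of $S$. *)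

(* Defs.v *)
From mathcomp Require Import all_boot all_order all_algebra finmap.
From mathcomp Require Import boolp classical_sets cardinality.

Set Implicit Arguments.
Unset Strict Implicit.
Unset Printing Implicit Defensive.

Import Order.TTheory GRing.Theory Num.Theory.
Local Open Scope card_scope.
Local Open Scope classical_set_scope.
Local Open Scope ring_scope.

(* Only meaningful on finite sets: [fset_set] sends infinite sets to [fset0]. *)
Definition card_of (T : choiceType) (X : set T) : nat := #|` fset_set X|%fset.

Section Words.
Variable A : finType.
Implicit Types (S X Y : set (seq A)) (u v w x y : seq A).

Definition factorial_set S : Prop :=
  forall u w, S w -> infix u w -> S u.

Definition recurrent S : Prop :=
  [/\ S <> [set [::]], factorial_set S &
      forall u w, S u -> S w -> exists2 v, S v & S (u ++ v ++ w)].

Definition left_ext S w : set A := [set a | S (a :: w)].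
Definition right_ext S w : set A := [set a | S (rcons w a)].
Definition bi_ext S w : set (A * A) := [set ab | S (ab.1 :: rcons w ab.2)].

Definition multiplicity S w : int :=
  (card_of (bi_ext S w))%:Z - (card_of (left_ext S w))%:Z
  - (card_of (right_ext S w))%:Z + 1.

Definition strong S : Prop :=
  factorial_set S /\ forall w, S w -> 0 <= multiplicity S w.
Definition weak S : Prop :=
  factorial_set S /\ forall w, S w -> multiplicity S w <= 0.
Definition neutral S : Prop :=
  factorial_set S /\ forall w, S w -> multiplicity S w = 0.

Definition prefix_code X : Prop :=
  ~ X [::] /\ forall x y, X x -> X y -> ~~ (prefix x y && (x != y)).
Definition suffix_code X : Prop :=
  ~ X [::] /\ forall x y, X x -> X y -> ~~ (suffix x y && (x != y)).
Definition bifix_code X : Prop := prefix_code X /\ suffix_code X.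

Definition maximal_bifix_code S X : Prop :=
  [/\ bifix_code X, X `<=` S &
      forall Y, bifix_code Y -> Y `<=` S -> ~ X `<` Y].

Definition star X : set (seq A) :=
  [set w | exists2 xs : seq (seq A), {in xs, forall x, X x} & w = flatten xs].

Definition parses X w : set (seq A * seq A * seq A) :=
  [set p | let: (v, x, u) := p in
    [/\ w = v ++ x ++ u,
        forall s, suffix s v -> ~ X s,
        forall s, prefix s u -> ~ X s &
        star X x]].

(* "d is the maximal number of parses of a word of S"; cardinals of the sets
   of parses are compared with that of [`I_d = {0, ..., d-1}]. *)
Definition is_degree S X (d : nat) : Prop :=
  (exists2 w, S w & parses X w #= `I_d) /\
  (forall w, S w -> parses X w #<= `I_d).

End Words.

(* Main.v *)
Require Import Defs.
From mathcomp Require Import all_boot all_order all_algebra finmap.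
From mathcomp Require Import boolp classical_sets cardinality.
From mathcomp Require Import ring zify.

Set Implicit Arguments.
Unset Strict Implicit.
Unset Printing Implicit Defensive.

Import Order.TTheory GRing.Theory Num.Theory.
Local Open Scope classical_set_scope.
Local Open Scope ring_scope.

(** Let [P] be the set of words of [S] without prefix in [X]; the parses of [w]
    correspond to the suffixes of [w] without prefix in [X], and [delta w] is
    their number. If a word of [P] were not a prefix of a word of [X], then by
    recurrence it would occur arbitrarily often in words of [S], which would
    have unboundedly many parses; so [P] is the finite set of proper prefixes
    of [X], and counting the edges of the tree of [X] gives
    [Card X - 1 = sum_{p in P} (r p - 1)].
    Since [delta] is monotone for factors and [P] is finite, recurrence gives
    [delta w = d] for every long [w] in [S]. As [delta (a w) - delta w] is the
    indicator of [P] at [a w] and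
    [m w = sum_{a in L w} (r (a w) - 1) - (r w - 1)], a summation by parts
    yields
    [Card X - 1 = d (Card A - 1) + sum_{w in S} (d - delta w) m w],
    where all coefficients [d - delta w] are nonnegative. *)

(** * Counting along duplicate-free lists; prefixes and suffixes of one word *)

Lemma card_eq_count (T : choiceType) (Z : set T) (s : seq T) :
  uniq s -> (forall x, Z x -> x \in s) ->
  (Z #= `I_(count (fun x => `[< Z x >]) s))%card.
Proof.
move=> us Zs; pose F := [fset x in [seq x <- s | `[< Z x >]]]%fset.
set n := count _ s; have -> : Z = [set` F].
  apply/seteqP; split => x /=; rewrite inE /= mem_filter; last by case/andP => /asboolP.
  by move=> Zx; rewrite Zs // andbT; apply/asboolP.
apply/card_eq_fsetP.
by rewrite card_fseq undup_id ?filter_uniq // size_filter.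
Qed.

(** The list [s] forces [Z] to be finite, so the default value of [card_of] on infinite sets cannot
    interfere. *)
Lemma card_of_count (T : choiceType) (Z : set T) (s : seq T) :
  uniq s -> (forall x, Z x -> x \in s) ->
  card_of Z = count (fun x => `[< Z x >]) s.
Proof. by move=> us Zs; apply/card_fset_set/card_eq_count. Qed.

Lemma count_sumz (T : Type) (p : pred T) (s : seq T) :
  (count p s)%:Z = \sum_(x <- s) (p x)%:Z.
Proof. by elim: s => [|x s IH] /=; rewrite ?big_nil // big_cons PoszD IH. Qed.

Lemma card_of_finType (T : finType) (Z : set T) :
  (card_of Z)%:Z = \sum_x (`[< Z x >])%:Z.
Proof.
rewrite (@card_of_count T Z (index_enum T)) ?index_enum_uniq //.
  exact: count_sumz.
by move=> x _; apply: mem_index_enum.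
Qed.

Lemma prefix_of_prefixes (T : eqType) (x y w : seq T) :
  prefix x w -> prefix y w -> (size x <= size y)%N -> prefix x y.
Proof.
by rewrite !prefixE => /eqP xw /eqP yw le; rewrite -yw take_takel ?xw.
Qed.

Lemma suffix_of_suffixes (T : eqType) (x y w : seq T) :
  suffix x w -> suffix y w -> (size x <= size y)%N -> suffix x y.
Proof.
by move=> xw yw le; apply: (prefix_of_prefixes xw yw); rewrite !size_rev.
Qed.

Lemma catIs (T : Type) (s : seq T) : injective (cat^~ s).
Proof.
elim/last_ind: s => [|s x IH] u v /=; first by rewrite !cats0.
by rewrite -!rcons_cat => /rcons_inj [/IH].
Qed.

(** * Sums over the words of bounded length *)

Section ShortWords.
Variable A : finType.
Implicit Types (w : seq A) (F : seq A -> int).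

Fixpoint short_words n : seq (seq A) :=
  if n is m.+1 then [::] :: [seq a :: w | a <- enum A, w <- short_words m]
  else [::].

Lemma mem_short_words n w : (w \in short_words n) = (size w < n)%N.
Proof.
elim: n w => [|n IH] [|a w] //=; rewrite inE /= ltnS -IH.
apply/allpairsP/idP => [[[b v] /= [_ vn [_ ->]]] //|wn].
by exists (a, w); rewrite mem_enum.
Qed.

Lemma short_words_uniq n : uniq (short_words n).
Proof.
elim: n => [|n IH] //=; apply/andP; split; first by apply/allpairsP => -[[? ?] []].
by apply: allpairs_uniq; rewrite ?enum_uniq // => -[a v] [b u] _ _ /= [-> ->].
Qed.

(** Splits off the first letter, to follow the growth of [parse_count] to the left;
    [short_words_rcons] splits off the last one, to follow the tree of [X]. *)
Lemma short_words_cons F n :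
  \sum_(w <- short_words n.+1) F w =
  F [::] + \sum_(w <- short_words n) \sum_a F (a :: w).
Proof. by rewrite /= big_cons big_allpairs_dep /= exchange_big /=; under eq_bigr do rewrite big_enum. Qed.

Lemma short_words_rcons F n :
  \sum_(w <- short_words n.+1) F w =
  F [::] + \sum_(w <- short_words n) \sum_a F (rcons w a).
Proof.
have E : perm_eq (short_words n.+1)
    ([::] :: [seq rcons w a | w <- short_words n, a <- enum A]).
  apply: uniq_perm; first exact: short_words_uniq.
    apply/andP; split; first by apply/allpairsP => -[[[|? ?] ?] []].
    apply: allpairs_uniq; rewrite ?enum_uniq ?short_words_uniq //.
    by move=> [a v] [b u] _ _ /= /rcons_inj [-> ->].
  move=> w; rewrite mem_short_words inE.
  case/lastP: w => [|w a] //; rewrite size_rcons ltnS -mem_short_words.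
  have -> : (rcons w a == [::]) = false by case: w.
  apply/idP/allpairsP => [wn|[[v b] /= [vn _ /rcons_inj [-> _]]] //].
  by exists (w, a); rewrite mem_enum.
by rewrite (perm_big _ E) big_cons big_allpairs_dep /=; congr (_ + _); apply: eq_bigr => w _; rewrite big_enum.
Qed.

(** Dropping the longest words turns both recursions into identities between sums over the same
    list. *)
Lemma short_words_trim F n : (forall w, size w = n -> F w = 0) ->
  \sum_(w <- short_words n.+1) F w = \sum_(w <- short_words n) F w.
Proof.
move=> F0; have := @mem_short_words n.+1; have := short_words_uniq n.+1.
move: (short_words n.+1) => L uL mL.
rewrite (bigID (fun w => (size w < n)%N)) /= [X in _ + X]big1_seq ?addr0.
  rewrite -big_filter; apply: perm_big; apply: uniq_perm.
  - by rewrite filter_uniq.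
  - exact: short_words_uniq.
  by move=> w; rewrite mem_filter mL mem_short_words; case: ltnP => //= /ltnW.
move=> w /andP[]; rewrite -leqNgt => nw; rewrite mL ltnS => wn.
by apply: F0; apply/eqP; rewrite eqn_leq wn.
Qed.

End ShortWords.

(** * Parses counted by suffixes *)

Section Parses.
Variables (A : finType) (X : set (seq A)).
Implicit Types (u v w x y s : seq A).

Definition no_prefix w : bool := `[< forall s, prefix s w -> ~ X s >].

Fixpoint suffixes w : seq (seq A) :=
  w :: (if w is _ :: w' then suffixes w' else [::]).

(** This is [delta]; [parses_card] identifies it with the number of parses. *)
Definition parse_count w : nat := count no_prefix (suffixes w).

Lemma mem_suffixes u w : (u \in suffixes w) = suffix u w.
Proof.
elim: w u => [|a w IH] u /=; first by rewrite inE suffixs0.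
rewrite inE IH; apply/orP/idP => [[/eqP->|uw]|/suffixP [[|b v] /= E]].
- exact: suffix_refl.
- exact: suffix_trans uw (suffix_cons _ _).
- by left; rewrite E.
- by right; case: E => _ ->; apply: suffix_suffix.
Qed.

Lemma suffixes_uniq w : uniq (suffixes w).
Proof.
elim: w => //= a w ->; rewrite andbT mem_suffixes.
by apply/negP => /size_suffix /=; rewrite ltnn.
Qed.

Lemma suffixes_rcons w a :
  suffixes (rcons w a) = rcons (map (rcons^~ a) (suffixes w)) [::].
Proof. by elim: w => //= b w ->. Qed.

Lemma parse_count_cons a w :
  parse_count (a :: w) = (no_prefix (a :: w) + parse_count w)%N.
Proof. by []. Qed.

Lemma parse_count_catl v w : (parse_count w <= parse_count (v ++ w))%N.
Proof.
by elim: v => //= a v IH; rewrite parse_count_cons; apply: leq_trans IH (leq_addl _ _).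
Qed.

Lemma no_prefix_rcons w a :
  no_prefix (rcons w a) = no_prefix w && ~~ `[< X (rcons w a) >].
Proof.
apply/asboolP/andP => [H|[/asboolP H /asboolP nX] s].
  split; first by apply/asboolP => s sw; apply/H/(prefix_trans sw)/prefix_rcons.
  by apply/asboolP; apply: H; apply: prefix_refl.
move=> /prefixP [t]; case/lastP: t => [|t b]; first by rewrite cats0 => <-.
by rewrite -rcons_cat => /rcons_inj [E _]; apply: H; rewrite E prefix_prefix.
Qed.

Lemma no_prefix_nil : ~ X [::] -> no_prefix [::].
Proof. by move=> X0; apply/asboolP => s; rewrite prefixs0 => /eqP ->. Qed.

Hypothesis sufX : suffix_code X.

Lemma suffix_code_comparable x y w :
  X x -> X y -> suffix x w -> suffix y w -> x = y.
Proof.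
have [_ H] := sufX.
move=> Xx Xy xw yw; apply/eqP; case: (leqP (size x) (size y)) => [|/ltnW] le.
  by have := H x y Xx Xy; rewrite (suffix_of_suffixes xw) //= => /negPn.
by have := H y x Xy Xx; rewrite (suffix_of_suffixes yw) //= eq_sym => /negPn.
Qed.

(* Appending [a] creates the suffix [::] and destroys at most one: the
   suffixes [u a] in [X] form a chain for the suffix order. *)
Lemma parse_count_rcons w a : (parse_count w <= parse_count (rcons w a))%N.
Proof.
rewrite /parse_count suffixes_rcons -cats1 count_cat count_map /=.
rewrite no_prefix_nil ?addn0; last exact: sufX.1.
pose c u := `[< X (rcons u a) >].
set P := filter no_prefix (suffixes w).
have -> : count (preim (rcons^~ a) no_prefix) (suffixes w) = count (predC c) P.
  by rewrite count_filter; apply: eq_count => u /=; rewrite no_prefix_rcons andbC.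
rewrite -size_filter -/P -(count_predC c) addnC leq_add2l -size_filter {}/P.
set L := filter c _.
have : uniq L by rewrite !filter_uniq ?suffixes_uniq.
have : {in L, forall u, X (rcons u a) /\ suffix u w}.
  by move=> u; rewrite !mem_filter mem_suffixes => /and3P [/asboolP].
case: L => [|u [|v L]] // H /= /andP[]; rewrite inE => /norP [/eqP nuv _] _.
have [|Xu su] := H u; first by rewrite inE eqxx.
have [|Xv sv] := H v; first by rewrite !inE eqxx orbT.
have /rcons_inj [] // : rcons u a = rcons v a.
by apply: (@suffix_code_comparable _ _ (rcons w a)) => //; rewrite suffix_rcons eqxx.
Qed.

Lemma parse_count_catr v w : (parse_count w <= parse_count (w ++ v))%N.
Proof.
elim/last_ind: v => [|v a IH]; first by rewrite cats0.
by rewrite -rcons_cat; apply: leq_trans IH (parse_count_rcons _ _).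
Qed.

Definition no_suffix v := forall s, suffix s v -> ~ X s.

(** Words of [X] are stripped from the right end; this stops because they are nonempty. *)
Lemma star_decomposition w : exists v x, [/\ w = v ++ x, no_suffix v & star X x].
Proof.
have [n] := ubnP (size w); elim: n w => // n IH w; rewrite ltnS => wn.
have [H|] := pselect (no_suffix w).
  by exists w, [::]; split; rewrite ?cats0 //; exists [::].
move=> /existsNP [s] /not_implyP [/suffixP [w' E] /contrapT Xs].
have s0 : (0 < size s)%N by case: s Xs {E} => // /sufX.1.
have [|v [x [E' nv [xs Hxs Ex]]]] := IH w'; first by move: wn; rewrite E size_cat; lia.
exists v, (x ++ s); split => //; first by rewrite E E' catA.
exists (rcons xs s); last by rewrite flatten_rcons Ex.
by move=> y; rewrite mem_rcons inE => /predU1P [->|/Hxs].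
Qed.

(** A last factor on one side only would be a suffix in [X] of the other remainder. Two last factors
    are suffixes of one word, hence equal in a suffix code, and cancel. *)
Lemma star_decomposition_uniq v v' x x' :
  no_suffix v -> no_suffix v' -> star X x -> star X x' ->
  v ++ x = v' ++ x' -> v = v' /\ x = x'.
Proof.
move=> nv nv' [xs Hxs ->] [xs' Hxs' ->] {x x'}.
elim/last_ind: xs xs' Hxs Hxs' => [|xs x IH] xs'; case/lastP: xs' => [|ys y] Hx Hy;
  rewrite ?flatten_rcons ?cats0 //.
- rewrite catA => E; case: (nv y); first by rewrite E suffix_suffix.
  by apply: Hy; rewrite mem_rcons inE eqxx.
- rewrite catA => E; case: (nv' x); first by rewrite -E suffix_suffix.
  by apply: Hx; rewrite mem_rcons inE eqxx.
move=> E; have Exy : x = y.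
  apply: (@suffix_code_comparable _ _ (v ++ flatten xs ++ x)).
  - by apply: Hx; rewrite mem_rcons inE eqxx.
  - by apply: Hy; rewrite mem_rcons inE eqxx.
  - by rewrite catA suffix_suffix.
  - by rewrite E catA suffix_suffix.
move: E; rewrite -{}Exy !catA => /catIs E.
have [|||-> ->] // := IH ys.
- by move=> z zx; apply: Hx; rewrite mem_rcons inE zx orbT.
- by move=> z zx; apply: Hy; rewrite mem_rcons inE zx orbT.
Qed.

(** A parse is determined by its last component, by uniqueness of the decomposition of the rest;
    existence shows that every suffix without prefix in [X] occurs. *)
Lemma parses_card w : (parses X w #= `I_(parse_count w))%card.
Proof.
pose f (p : seq A * seq A * seq A) := p.2.
have finj : {in parses X w &, injective f}.
  move=> [[v x] u] [[v' x'] u'] /set_mem [E nv _ sx] /set_mem [E' nv' _ sx'] /= Eu.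
  rewrite /f /= in Eu; subst u'; move: E'; rewrite E !catA => /catIs Ev.
  by have [-> ->] := star_decomposition_uniq nv nv' sx sx' Ev.
apply: card_eq_trans (card_esym (inj_card_eq finj)) _.
pose Z := [set u | suffix u w /\ no_prefix u].
have -> : f @` parses X w = Z.
  apply/seteqP; split => [_ [[[v x] u] [E nv nu sx] <-]|u [/suffixP [w' E] nu]].
    by split; [rewrite E catA suffix_suffix | apply/asboolP].
  have [v [x [E' nv sx]]] := star_decomposition w'.
  by exists (v, x, u) => //; split => //; [rewrite E E' catA | apply/asboolP].
have := @card_eq_count _ Z _ (suffixes_uniq w) _.
have -> : count (fun u => `[< Z u >]) (suffixes w) = parse_count w.
  apply: eq_in_count => u; rewrite mem_suffixes => uw.
  by apply/asboolP/idP => [[]|].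
by apply => u []; rewrite mem_suffixes.
Qed.

End Parses.

(** * Parse counts in [S] and proper prefixes of the code *)

Section Degree.
Variables (A : finType) (S X : set (seq A)) (d : nat).
Hypotheses (recS : recurrent S) (letS : forall a : A, S [:: a]).
Hypotheses (finX : finite_set X) (XS : X `<=` S).
Hypotheses (bifX : bifix_code X) (degX : is_degree S X d).
Implicit Types (u v w x y s p : seq A).

Let facS : factorial_set S. Proof. by case: recS. Qed.
Let preX : prefix_code X := bifX.1.
Let sufX : suffix_code X := bifX.2.

Lemma S_catl u w : S (u ++ w) -> S w.
Proof. by move=> H; apply: facS H _; apply/suffixW/suffix_suffix. Qed.

Lemma S_catr u w : S (u ++ w) -> S u.
Proof. by move=> H; apply: facS H _; apply/prefixW/prefix_prefix. Qed.

Lemma S_nil : S [::].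
Proof. by have [[w /(@S_catr [::] w)]] := degX. Qed.

Lemma S_cons a w : S (a :: w) -> S w.
Proof. exact: (@S_catl [:: a]). Qed.

Lemma S_rcons a w : S (rcons w a) -> S w.
Proof. by rewrite -cats1; apply: S_catr. Qed.

Lemma parse_count_le w : S w -> (parse_count X w <= d)%N.
Proof.
move=> Sw; rewrite -card_le_II.
have /card_eqPle [_ le] := parses_card sufX w.
exact: card_le_trans le (degX.2 w Sw).
Qed.

Lemma parse_count_attained : exists2 w, S w & parse_count X w = d.
Proof.
have [[w Sw cw] _] := degX; exists w => //; apply/card_eq_II.
exact: card_eq_trans (card_esym (parses_card sufX w)) cw.
Qed.

(* If no word of [X] is comparable to [u], every occurrence of [u] starts a
   suffix without prefix in [X]; recurrence gives unboundedly many of them. *)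
Lemma nonempty_prefix_of_code a u : S (a :: u) -> no_prefix X (a :: u) ->
  exists2 x, X x & prefix (a :: u) x.
Proof.
move=> Su nu; apply: contrapT => nX.
have nuw w : no_prefix X (a :: u ++ w).
  apply/asboolP => s sw Xs.
  have uw : prefix (a :: u) (a :: u ++ w) by rewrite -cat_cons prefix_prefix.
  have [le|/ltnW le] := leqP (size s) (size (a :: u)).
    by move: nu => /asboolP /(_ s); apply => //; apply: prefix_of_prefixes sw uw le.
  by apply: nX; exists s => //; apply: prefix_of_prefixes uw sw le.
suff H n : exists2 w, S (a :: u ++ w) & (n <= parse_count X (a :: u ++ w))%N.
  by have [w Sw] := H d.+1; rewrite ltnNge parse_count_le.
elim: n => [|n [w Sw nw]]; first by exists [::]; rewrite ?cats0.
have [_ _ /(_ _ _ Su Sw) [v _ Sv]] := recS.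
exists (v ++ a :: u ++ w) => //; rewrite parse_count_cons nuw ltnS.
by rewrite catA; apply: leq_trans nw (parse_count_catl _ _ _).
Qed.

(** For empty [p] this says that [X] is nonempty: [S] has a nonempty word, hence there is a letter,
    which begins a word of [X] or has a prefix in [X]. *)
Lemma prefix_of_code p : S p -> no_prefix X p -> exists2 x, X x & prefix p x.
Proof.
case: p => [_ _|a p]; last exact: nonempty_prefix_of_code.
have [S1 _ _] := recS.
have [w Sw w0] : exists2 w, S w & w != [::].
  apply: contrapT => H; apply: S1; apply/seteqP; split => [w Sw /=|_ ->]; last exact: S_nil.
  by apply/eqP/negP => w0; apply: H; exists w => //; apply/negP.
case: w w0 Sw => // a w _ _.
have [H|/asboolPn] := boolP (no_prefix X [:: a]).
  by have [x Xx _] := nonempty_prefix_of_code (letS a) H; exists x; rewrite ?prefix0s.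
by move=> /existsNP [s] /not_implyP [_ /contrapT Xs]; exists s; rewrite ?prefix0s.
Qed.

Lemma code_size_bound : exists M, forall x, X x -> (size x < M)%N.
Proof.
have /finite_seqP [s Es] := finX; exists (\max_(x <- s) size x).+1 => x.
by rewrite Es ltnS /= => xs; apply: leq_bigmax_seq.
Qed.

(** Recurrence joins a word with [d] parses to [w]. The result has at least [d] parses, and its
    suffixes longer than [w] are too long to be in [P], so all are counted in [w]. *)
Lemma parse_count_long M w : (forall x, X x -> (size x < M)%N) ->
  S w -> (M <= size w)%N -> parse_count X w = d.
Proof.
move=> HM Sw Mw; apply/eqP; rewrite eqn_leq parse_count_le //=.
have [w0 Sw0 <-] := parse_count_attained.
have [_ _ /(_ _ _ Sw0 Sw) [v _]] := recS; rewrite catA => Sv.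
apply: (@leq_trans (parse_count X ((w0 ++ v) ++ w))).
  by rewrite -catA; apply: parse_count_catr.
elim: (w0 ++ v) Sv => //= a t IH St.
rewrite parse_count_cons; apply: leq_trans (IH (S_cons St)).
case: (boolP (no_prefix X _)) => // H; have [x Xx /size_prefix] := prefix_of_code St H.
by move=> /=; rewrite size_cat; have := HM x Xx; lia.
Qed.

(** * Integer indicators and the two summations *)

Definition inS w : int := (`[< S w >])%:Z.
Definition inX w : int := (`[< X w >])%:Z.
Definition inP w : int := (`[< S w >] && no_prefix X w)%:Z.
(** This is [r(w) - 1]: for [w] in [P], the number of children in the tree of [X], minus one. *)
Definition excess w : int := \sum_a inS (rcons w a) - 1.
Definition defect w : int := d%:Z - (parse_count X w)%:Z.

(** As [X] is a prefix code, a word of [X] without its last letter is in [P]; so the children of a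
    node of [P] split into inner nodes, in [P], and leaves, in [X]. *)
Lemma inP_rcons w a :
  inP (rcons w a) + inX (rcons w a) = inP w * inS (rcons w a).
Proof.
rewrite /inP /inX /inS no_prefix_rcons.
have [Xw|nXw] := asboolP (X (rcons w a)).
  rewrite asboolT /=; last exact: XS.
  rewrite asboolT; last by apply: S_rcons (XS Xw).
  rewrite andbF /= mulr1 add0r; suff -> : no_prefix X w by [].
  apply/asboolP => s sw Xs; have := preX.2 _ _ Xs Xw => /negP [].
  rewrite (prefix_trans sw (prefix_rcons _ _)) /=; apply/eqP => E.
  by move: (size_prefix sw); rewrite E size_rcons ltnn.
rewrite andbT addr0; have [Sw|nSw] := asboolP (S (rcons w a)); last by rewrite mulr0.
by rewrite mulr1 (asboolT (S_rcons Sw)).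
Qed.

Lemma inP_nil : inP [::] = 1.
Proof. by rewrite /inP (asboolT S_nil) no_prefix_nil //; exact: sufX.1. Qed.

Lemma parse_count_nil : parse_count X [::] = 1%N.
Proof. by rewrite /parse_count /= no_prefix_nil //; exact: sufX.1. Qed.

Lemma excess_nil : excess [::] = #|A|%:Z - 1.
Proof.
rewrite /excess (eq_bigr (fun=> 1)) => [|a _]; last by rewrite /inS (asboolT (letS a)).
by rewrite sumr_const natz.
Qed.

(** Grouping [E(w)] by left letter gives [e(w)] as the sum of [r(aw)] over [a] in [L(w)]. *)
Lemma multiplicityE w : S w ->
  multiplicity S w = \sum_a inS (a :: w) * excess (a :: w) - excess w.
Proof.
move=> Sw; rewrite /multiplicity !card_of_finType /excess.
have -> : \sum_ab (`[< bi_ext S w ab >])%:Z =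
    \sum_a inS (a :: w) * \sum_b inS (rcons (a :: w) b).
  rewrite -(pair_big xpredT xpredT (fun a b => (`[< S (a :: rcons w b) >])%:Z)) /=.
  apply: eq_bigr => a _; rewrite /inS mulr_sumr; apply: eq_bigr => b _.
  have [/(S_rcons (w := a :: w)) Saw|] := asboolP (S (a :: rcons w b)).
    by rewrite asboolT.
  by rewrite mulr0.
rewrite [X in _ = X - _](eq_bigr _ (fun a _ => mulrBr _ _ _)) sumrB.
under [X in _ = _ - X - _]eq_bigr do rewrite mulr1.
by rewrite opprB addrA addrAC.
Qed.

Section Sums.
Variable M : nat.
Hypothesis HM : forall x, X x -> (size x < M)%N.

Lemma inX_long w : size w = M -> inX w = 0.
Proof. by move=> wM; rewrite /inX asboolF // => /HM; rewrite wM ltnn. Qed.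

Lemma inP_long w : size w = M -> inP w = 0.
Proof.
move=> wM; rewrite /inP; case: andP => // -[/asboolP Sw nw].
have [x /HM xM /size_prefix] := prefix_of_code Sw nw.
by rewrite wM leqNgt xM.
Qed.

(** The nodes of the tree, [P] and [X] together, are counted as the root plus all children of nodes
    of [P]; then [Card P] cancels. *)
Lemma card_code_excess :
  (card_of X)%:Z = 1 + \sum_(w <- short_words A M) inP w * excess w.
Proof.
rewrite (@card_of_count _ X (short_words A M)) ?short_words_uniq //; last first.
  by move=> x /HM; rewrite mem_short_words.
rewrite count_sumz.
have := @short_words_rcons A (fun w => inP w + inX w) M.
rewrite short_words_trim => [|w wM]; last by rewrite inP_long ?inX_long.
rewrite inP_nil /inX asboolF ?addr0; last exact: sufX.1.
rewrite [X in _ = _ + X](eq_bigr (fun w => inP w * excess w + inP w)) => [|w _]; last first.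
  rewrite (eq_bigr _ (fun a _ => inP_rcons w a)) -mulr_sumr /excess; ring.
rewrite !big_split /= addrA [LHS]addrC => /addIr; exact.
Qed.

Lemma excess_sum :
  \sum_(w <- short_words A M) inP w * excess w =
  d%:Z * (#|A|%:Z - 1) +
  \sum_(w <- short_words A M) inS w * defect w * multiplicity S w.
Proof.
pose H w := inS w * defect w * excess w.
pose K w := inP w * excess w.
(* For [aw] in [S], [defect w] is [defect (a :: w)] plus the indicator of [P] at [aw]; multiplied by
   [excess (a :: w)], these give [H] and [K]. *)
have HK w : inS w * defect w * multiplicity S w + H w =
    \sum_a (H (a :: w) + K (a :: w)).
  rewrite /H /inS; case: (asboolP (S w)) => [Sw|nSw]; last first.
    rewrite !mul0r addr0 big1 // => a _; rewrite /H /K /inP /inS asboolF ?mul0r //.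
    by move=> /S_cons.
  rewrite mul1r multiplicityE // -mulrDr subrK mulr_sumr; apply: eq_bigr => a _.
  rewrite /H /K /inP /defect parse_count_cons /inS PoszD.
  by case: (`[< S (a :: w) >]); case: (no_prefix X _) => /=; ring.
have := @short_words_cons A (fun w => H w + K w) M.
(* At length [M], [K] vanishes since no word of [P] is that long, and [H] since [defect] is zero on
   long words of [S]. *)
rewrite short_words_trim => [|w wM]; last first.
  rewrite /H /K inP_long // /inS /defect; case: asboolP => [Sw|_]; last by rewrite !mul0r.
  by rewrite (parse_count_long HM) ?wM // subrr mulr0 !mul0r.
rewrite -(eq_bigr _ (fun w _ => HK w)) !big_split /= => E.
(* The empty word has one parse: its [excess] gets the coefficient [d - 1] from [H] and [1] from
   [K]. *)
have E0 : H [::] + K [::] = d%:Z * (#|A|%:Z - 1).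
  rewrite /H /K inP_nil /inS asboolT; last exact: S_nil.
  by rewrite /defect parse_count_nil excess_nil !mul1r mulrBl mul1r subrK.
by apply: (addrI (\sum_(w <- short_words A M) H w)); rewrite {}E E0 [RHS]addrC addrA.
Qed.

End Sums.

Lemma card_code_multiplicity : exists ws : seq (seq A),
  (card_of X)%:Z - 1 = d%:Z * (#|A|%:Z - 1) +
    \sum_(w <- ws) inS w * defect w * multiplicity S w.
Proof.
have [M HM] := code_size_bound; exists (short_words A M).
by rewrite (card_code_excess HM) (excess_sum HM); ring.
Qed.

Lemma inS_defect_ge0 w : 0 <= inS w * defect w.
Proof.
rewrite /inS /defect; case: asboolP => [Sw|_]; last by rewrite mul0r.
by rewrite mul1r subr_ge0 lez_nat parse_count_le.
Qed.

End Degree.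

Theorem theorem3p6 (A : finType) (S X : set (seq A)) (d : nat)
    (hrec : recurrent S) (hA : forall a : A, S [:: a])
    (hfin : finite_set X) (hmax : maximal_bifix_code S X)
    (hd : is_degree S X d) :
  let k : int := #|A|%:Z - 1 in
  [/\ strong S -> d%:Z * k <= (card_of X)%:Z - 1,
      weak S -> (card_of X)%:Z - 1 <= d%:Z * k &
      neutral S -> (card_of X)%:Z - 1 = d%:Z * k].
Proof.
move=> k; have [bif XS _] := hmax.
have [ws ->] := card_code_multiplicity hrec hA hfin XS bif hd.
have c0 := inS_defect_ge0 bif hd.
have outS w : ~ S w -> inS S w = 0 by move=> nSw; rewrite /inS asboolF.
(* By [c0] each summand with [w] in [S] inherits the sign of the multiplicity; the others vanish. *)
split=> -[_ H].
- rewrite lerDl sumr_ge0 // => w _.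
  have [Sw|/outS ->] := pselect (S w); last by rewrite !mul0r.
  by rewrite mulr_ge0 ?H.
- rewrite gerDl; apply: sumr_le0 => w _.
  have [Sw|/outS ->] := pselect (S w); last by rewrite !mul0r.
  by rewrite mulr_ge0_le0 ?H.
- rewrite big1 ?addr0 // => w _.
  have [Sw|/outS ->] := pselect (S w); last by rewrite !mul0r.
  by rewrite H ?mulr0.
Qed.
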